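(* Let $(W,S)$ be an arbitrary Coxeter system and let $\underline{w}=(s_1,\ldots,s_n)$ be any expression (a finite sequence of elements of $S$, not necessarily reduced). Then the Bott--Samelson ring $\overline{\mathrm{BS}}(\underline{w})=\mathbb{R}\otimes_{R^{s_1}}R\otimes_{R^{s_2}}\cdots\otimes_{R^{s_n}}R$ has the following quadratic presentation as a graded $\mathbb{R}$-algebra (each $x_i$ having degree $1$): $$\overline{\mathrm{BS}}(s_1,s_2,\ldots,s_n)\;\cong\;\frac{\mathbb{R}[x_1,x_2,\ldots,x_n]}{(q_1,q_2,\ldots,q_n)},$$ where for $m=1,\ldots,n$ $$q_m:=x_m^2-\Bigl(\sum_{l=1}^{m-1}q_{lm}x_l\Bigr)^2=x_m^2-\sum_{1\le i\le j\le m-1}(2-\delta_{ij})\,q_{im}q_{jm}\,x_ix_j ,$$ $\delta_{ij}$ is the Kronecker delta, and the real numbers $q_{lm}$ are the entries of the matrix $Q_{\underline{w}}$ defined in the context.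
   Context: A Coxeter system $(W,S)$ has $S$ finite, $W=\langle s\in S\mid (st)^{m_{st}}=\mathrm{id}\text{ for } s,t\in S,\ m_{st}<\infty\rangle$, with $m_{ss}=1$ and $m_{st}=m_{ts}\in\{2,3,\ldots\}\cup\{\infty\}$ for $s\ne t$. Convention: $\pi/m_{st}=0$ if $m_{st}=\infty$. Geometric representation: $V$ is the real vector space with basis $\{\alpha_s\mid s\in S\}$ and symmetric bilinear form $(\alpha_s,\alpha_t)=-\cos\frac{\pi}{m_{st}}$; $s\in S$ acts by $s(\lambda)=\lambda-2(\lambda,\alpha_s)\alpha_s$. Let $R=\operatorname{Sym}(V)=\mathbb{R}[\alpha_s\mid s\in S]$, graded with $\deg\alpha_s=1$, with the induced action of $W$ by algebra automorphisms. $R^s$ is the subring of $s$-invariant polynomials. Bott--Samelson ring: $\overline{\mathrm{BS}}(\underline{w}):=\mathbb{R}\otimes_{R^{s_1}}R\otimes_{R^{s_2}}\cdots\otimes_{R^{s_n}}R$, where $R$ (hence $R^{s_1}$) acts on $\mathbb{R}$ through the quotient map $R\to\mathbb{R}$ killing all elements of positive degree; multiplication is componentwise, and the grading is the one induced from $R$. Matrix $Q_{\underline{w}}$: let $\tilde R_{\underline{w}}=(\tilde r_{ij})_{1\le i,j\le n}$ with $\tilde r_{ij}=\cos\frac{\pi}{m_{s_is_j}}$ if $i<j$ and $\tilde r_{ij}=0$ if $i\ge j$ (so $\tilde r_{ij}=\cos\pi=-1$ when $i<j$ and $s_i=s_j$). Then $Q_{\underline{w}}=(q_{ij})_{1\le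 i,j\le n}:=\tilde R_{\underline{w}}+\tilde R_{\underline{w}}^2+\cdots+\tilde R_{\underline{w}}^n$. *)

(* Defs.v *)
From HB Require Import structures.
From mathcomp Require Import all_boot all_order all_algebra.
From mathcomp Require Import generic_quotient ring_quotient.
From mathcomp Require Import boolp reals trigo.
From mathcomp Require Import mpoly.

Set Implicit Arguments.
Unset Strict Implicit.
Unset Printing Implicit Defensive.

Import GRing.Theory.

Local Open Scope ring_scope.
Local Open Scope quotient_scope.

(* A Coxeter matrix on S; None stands for the entry infinity. *)
Record coxeter_matrix (S : finType) := CoxeterMatrix {
  coxm :> S -> S -> option nat;
  coxm_diag : forall s, coxm s s = Some 1%N;
  coxm_sym : forall s t, coxm s t = coxm t s;
  coxm_offdiag : forall s t k, s != t -> coxm s t = Some k -> (2 <= k)%N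
}.

Definition coxeter_relations (S : finType) (m : coxeter_matrix S)
    (G : groupType) (f : S -> G) : Prop :=
  forall s t k, m s t = Some k -> ((f s * f t) ^+ k = 1)%g.

(* The last two fields are the universal property of the presentation
   W = < s in S | (st)^(m_st) = id for m_st finite >. *)
Record coxeter_system := CoxeterSystem {
  cox_group : groupType;
  cox_index : finType;
  cox_matrix : coxeter_matrix cox_index;
  cox_gen : cox_index -> cox_group;
  cox_rel : coxeter_relations cox_matrix cox_gen;
  cox_lift : forall (G : groupType) (f : cox_index -> G),
    coxeter_relations cox_matrix f ->
    exists phi : {multiplicative cox_group -> G},
      forall s, phi (cox_gen s) = f s;
  cox_lift_uniq : forall (G : groupType)
      (phi psi : {multiplicative cox_group -> G}),
    (forall s, phi (cox_gen s) = psi (cox_gen s)) -> phi =1 psi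
}.

Section GeometricRepresentation.
Variables (K : realType) (S : finType) (m : coxeter_matrix S).

Definition cox_angle (s t : S) : K :=
  if m s t is Some k then pi / k%:R else 0.

(* V, in coordinates with respect to the basis (alpha_s). *)
Definition cox_space := {ffun S -> K^o}.

Definition cox_root (s : S) : cox_space := [ffun t => (t == s)%:R].

Definition cox_form (v w : cox_space) : K :=
  \sum_s \sum_t v s * w t * - cos (cox_angle s t).

Definition cox_refl (s : S) (v : cox_space) : cox_space :=
  v - (2 * cox_form v (cox_root s)) *: cox_root s.

(* Sym(V) is the polynomial ring in the alpha_s; cox_poly is the inclusion of
   V as its degree-one part. *)
Definition cox_sym := {mpoly K[#|S|]}.

Definition cox_poly (v : cox_space) : cox_sym :=
  \sum_s v s *: 'X_(enum_rank s).

Definition cox_act (s : S) : cox_sym -> cox_sym :=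
  comp_mpoly [tuple cox_poly (cox_refl s (cox_root (enum_val i))) | i < #|S|].

HB.instance Definition _ s := GRing.LRMorphism.on (cox_act s).

Definition cox_inv (s : S) : {pred cox_sym} := fun p => cox_act s p == p.

Lemma cox_inv_subring s : subring_closed (cox_inv s).
Proof.
split=> [|p q|p q]; rewrite !unfold_in ?rmorph1 //.
  by move=> /eqP hp /eqP hq; rewrite rmorphB /= hp hq.
by move=> /eqP hp /eqP hq; rewrite rmorphM /= hp hq.
Qed.

HB.instance Definition _ s :=
  GRing.isSubringClosed.Build cox_sym (cox_inv s) (cox_inv_subring s).

Record cox_inv_ring (s : S) :=
  CoxInv { cox_inv_val : cox_sym; _ : cox_inv_val \in cox_inv s }.

HB.instance Definition _ s := [isSub for @cox_inv_val s].
HB.instance Definition _ s := [Choice of cox_inv_ring s by <:].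
HB.instance Definition _ s :=
  [SubChoice_isSubComNzRing of cox_inv_ring s by <:].

Definition cox_inv_incl s : {rmorphism cox_inv_ring s -> cox_sym} := val.

End GeometricRepresentation.

Section TensorProduct.
Variables (B A C : comPzRingType).
Variables (f : {rmorphism B -> A}) (g : {rmorphism B -> C}).

(* The list [:: (a1, c1); ...; (ak, ck)] stands for the formal sum of the
   tensors a1 (x) c1, ..., ak (x) ck. Formal sums have no cancellation, so the
   zero rules do not follow from additivity; with them every class has the
   opposite given by (-a) (x) c. *)
Inductive tensor_eq : seq (A * C) -> seq (A * C) -> Prop :=
| tensor_eq_perm u v : perm_eq u v -> tensor_eq u v
| tensor_eq_sym u v : tensor_eq u v -> tensor_eq v u
| tensor_eq_trans u v w : tensor_eq u v -> tensor_eq v w -> tensor_eq u w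
| tensor_eq_cat u u' v v' :
    tensor_eq u u' -> tensor_eq v v' -> tensor_eq (u ++ v) (u' ++ v')
| tensor_eq_0l c : tensor_eq [:: (0, c)] [::]
| tensor_eq_0r a : tensor_eq [:: (a, 0)] [::]
| tensor_eq_Dl a a' c : tensor_eq [:: (a + a', c)] [:: (a, c); (a', c)]
| tensor_eq_Dr a c c' : tensor_eq [:: (a, c + c')] [:: (a, c); (a, c')]
| tensor_eq_balanced a b c :
    tensor_eq [:: (a * f b, c)] [:: (a, g b * c)].

Definition tensor_rel : rel (seq (A * C)) := fun u v => `[< tensor_eq u v >].

Lemma tensor_eq_refl u : tensor_eq u u.
Proof. exact/tensor_eq_perm/perm_refl. Qed.

Lemma tensor_rel_equiv : equiv_class_of tensor_rel.
Proof.
split=> [u|u v|v u w]; first exact/asboolP/tensor_eq_refl.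
  by apply/asboolP/asboolP; exact: tensor_eq_sym.
by move=> /asboolP uv /asboolP vw; apply/asboolP/(tensor_eq_trans uv).
Qed.

Canonical tensor_rel_equiv_rel := EquivRelPack tensor_rel_equiv.
Canonical tensor_rel_encModRel := defaultEncModRel tensor_rel.

Definition tensor := {eq_quot tensor_rel}.

HB.instance Definition _ : EqQuotient _ tensor_rel tensor :=
  EqQuotient.on tensor.
HB.instance Definition _ := Choice.on tensor.

Definition tensor_sum (u : seq (A * C)) : tensor := \pi u.

Lemma tensor_sumP u v : tensor_sum u = tensor_sum v <-> tensor_eq u v.
Proof.
split=> [/eqmodP /asboolP //|uv]; by apply/eqmodP/asboolP.
Qed.

Lemma tensor_sumK (x : tensor) : tensor_sum (repr x) = x.
Proof. exact: reprK. Qed.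

Lemma tensor_reprK u : tensor_eq (repr (tensor_sum u)) u.
Proof. by apply/tensor_sumP; rewrite tensor_sumK. Qed.

Definition formal_opp (u : seq (A * C)) := [seq (- x.1, x.2) | x <- u].

Definition formal_mul (u v : seq (A * C)) :=
  [seq (x.1 * y.1, x.2 * y.2) | x <- u, y <- v].

Definition tensor_add (x y : tensor) := tensor_sum (repr x ++ repr y).
Definition tensor_opp (x : tensor) := tensor_sum (formal_opp (repr x)).
Definition tensor_mul (x y : tensor) :=
  tensor_sum (formal_mul (repr x) (repr y)).

Lemma tensor_addE u v :
  tensor_add (tensor_sum u) (tensor_sum v) = tensor_sum (u ++ v).
Proof. by apply/tensor_sumP/tensor_eq_cat; exact: tensor_reprK. Qed.

Lemma formal_opp_eq u v :
  tensor_eq u v -> tensor_eq (formal_opp u) (formal_opp v).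
Proof.
elim=> {u v} [u v uv|u v _ uv|u v w _ uv _|u u' v v' _ uu' _ vv'|c|a|a a' c
             |a c c'|a b c] /=.
- exact/tensor_eq_perm/perm_map.
- exact: tensor_eq_sym.
- exact: tensor_eq_trans.
- by rewrite /formal_opp !map_cat; apply: tensor_eq_cat.
- rewrite oppr0; exact: tensor_eq_0l.
- exact: tensor_eq_0r.
- rewrite opprD; exact: tensor_eq_Dl.
- exact: tensor_eq_Dr.
- rewrite -mulNr; exact: tensor_eq_balanced.
Qed.

Lemma tensor_oppE u : tensor_opp (tensor_sum u) = tensor_sum (formal_opp u).
Proof. exact/tensor_sumP/formal_opp_eq/tensor_reprK. Qed.

Lemma formal_mul_cons x u v :
  formal_mul (x :: u) v
  = [seq (x.1 * y.1, x.2 * y.2) | y <- v] ++ formal_mul u v.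
Proof. by []. Qed.

Lemma formal_mulDl u v w :
  formal_mul (u ++ v) w = formal_mul u w ++ formal_mul v w.
Proof. exact: allpairs_cat. Qed.

Lemma formal_mulC u v : perm_eq (formal_mul u v) (formal_mul v u).
Proof.
elim: u => [|x u IH] /=; first by elim: v.
rewrite formal_mul_cons perm_sym.
apply: (@perm_trans _ ([seq (y.1 * x.1, y.2 * x.2) | y <- v] ++ formal_mul v u)).
  exact/permPl/perm_allpairs_consr.
rewrite perm_sym perm_cat //.
suff -> : [seq (x.1 * y.1, x.2 * y.2) | y <- v]
         = [seq (y.1 * x.1, y.2 * x.2) | y <- v] by [].
by apply: eq_map => y; rewrite mulrC (mulrC x.2).
Qed.

Lemma formal_mul1 x v :
  formal_mul [:: x] v = [seq (x.1 * y.1, x.2 * y.2) | y <- v].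
Proof. exact: cats0. Qed.

Lemma formal_mul_map x (u v : seq (A * C)) :
  tensor_eq u v ->
  tensor_eq [seq (x.1 * y.1, x.2 * y.2) | y <- u]
            [seq (x.1 * y.1, x.2 * y.2) | y <- v].
Proof.
elim=> {u v} [u v uv|u v _ uv|u v w _ uv _|u u' v v' _ uu' _ vv'|c|a|a a' c
             |a c c'|a b c] /=.
- exact/tensor_eq_perm/perm_map.
- exact: tensor_eq_sym.
- exact: tensor_eq_trans.
- by rewrite !map_cat; apply: tensor_eq_cat.
- rewrite mulr0; exact: tensor_eq_0l.
- rewrite mulr0; exact: tensor_eq_0r.
- rewrite mulrDr; exact: tensor_eq_Dl.
- rewrite mulrDr; exact: tensor_eq_Dr.
- rewrite mulrA (mulrCA _ (g b)); exact: tensor_eq_balanced.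
Qed.

Lemma formal_mul_eqr u v v' :
  tensor_eq v v' -> tensor_eq (formal_mul u v) (formal_mul u v').
Proof.
move=> vv'; elim: u => [|x u IH]; first exact: tensor_eq_refl.
by rewrite !formal_mul_cons; apply: tensor_eq_cat => //; apply: formal_mul_map.
Qed.

Lemma formal_mul_eql u u' v :
  tensor_eq u u' -> tensor_eq (formal_mul u v) (formal_mul u' v).
Proof.
move=> uu'; apply: tensor_eq_trans (tensor_eq_perm (formal_mulC _ _)) _.
apply: tensor_eq_trans (formal_mul_eqr _ uu') _.
exact/tensor_eq_perm/formal_mulC.
Qed.

Lemma tensor_mulE u v :
  tensor_mul (tensor_sum u) (tensor_sum v) = tensor_sum (formal_mul u v).
Proof.
apply/tensor_sumP/(tensor_eq_trans (formal_mul_eql _ (tensor_reprK _))).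
exact/formal_mul_eqr/tensor_reprK.
Qed.

Lemma tensor_addA : associative tensor_add.
Proof.
move=> x y z; rewrite -(tensor_sumK x) -(tensor_sumK y) -(tensor_sumK z).
by rewrite !tensor_addE catA.
Qed.

Lemma tensor_addC : commutative tensor_add.
Proof.
move=> x y; rewrite -(tensor_sumK x) -(tensor_sumK y) !tensor_addE.
by apply/tensor_sumP/tensor_eq_perm; rewrite perm_catC.
Qed.

Lemma tensor_add0 : left_id (tensor_sum [::]) tensor_add.
Proof. by move=> x; rewrite -(tensor_sumK x) tensor_addE. Qed.

Lemma tensor_addN : left_inverse (tensor_sum [::]) tensor_opp tensor_add.
Proof.
move=> x; rewrite -(tensor_sumK x) tensor_oppE tensor_addE.
apply/tensor_sumP; elim: (repr x) => [|[a c] u IH] /=.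
  exact: tensor_eq_refl.
apply: (@tensor_eq_trans _ ([:: (- a, c); (a, c)] ++ (formal_opp u ++ u))).
  apply: tensor_eq_perm; rewrite /= perm_cons.
  by rewrite perm_sym -cat1s perm_catCA.
apply: (@tensor_eq_trans _ ([:: (- a + a, c)] ++ [::])); last first.
  rewrite addNr cats0; exact: tensor_eq_0l.
by apply: tensor_eq_cat => //; apply/tensor_eq_sym/tensor_eq_Dl.
Qed.

HB.instance Definition _ := GRing.isZmodule.Build tensor
  tensor_addA tensor_addC tensor_add0 tensor_addN.

Lemma tensor_mulC : commutative tensor_mul.
Proof.
move=> x y; rewrite -(tensor_sumK x) -(tensor_sumK y) !tensor_mulE.
exact/tensor_sumP/tensor_eq_perm/formal_mulC.
Qed.

Lemma formal_mulA u v w :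
  formal_mul u (formal_mul v w) = formal_mul (formal_mul u v) w.
Proof.
elim: u => [|x u IH] //; rewrite !formal_mul_cons formal_mulDl -{}IH.
congr (_ ++ _); elim: v => [|y v IH] //.
rewrite map_cons !formal_mul_cons map_cat {}IH -map_comp; congr (_ ++ _).
by apply: eq_map => z /=; rewrite !mulrA.
Qed.

Lemma tensor_mulA : associative tensor_mul.
Proof.
move=> x y z; rewrite -(tensor_sumK x) -(tensor_sumK y) -(tensor_sumK z).
by rewrite !tensor_mulE formal_mulA.
Qed.

Lemma tensor_mul1 : left_id (tensor_sum [:: (1, 1)]) tensor_mul.
Proof.
move=> x; rewrite -(tensor_sumK x) tensor_mulE formal_mul1.
congr tensor_sum; rewrite -[RHS]map_id; apply: eq_map => -[a c] /=.
by rewrite !mul1r.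
Qed.

Lemma tensor_mulDl : left_distributive tensor_mul +%R.
Proof.
move=> x y z; rewrite -(tensor_sumK x) -(tensor_sumK y) -(tensor_sumK z).
rewrite [X in tensor_mul X _]tensor_addE !tensor_mulE [RHS]tensor_addE.
by rewrite formal_mulDl.
Qed.

HB.instance Definition _ := GRing.Zmodule_isComPzRing.Build tensor
  tensor_mulA tensor_mulC tensor_mul1 tensor_mulDl.

Definition pure (a : A) (c : C) : tensor := tensor_sum [:: (a, c)].

Lemma pureDl a a' c : pure (a + a') c = pure a c + pure a' c.
Proof. by rewrite [RHS]tensor_addE; apply/tensor_sumP/tensor_eq_Dl. Qed.

Lemma pureDr a c c' : pure a (c + c') = pure a c + pure a c'.
Proof. by rewrite [RHS]tensor_addE; apply/tensor_sumP/tensor_eq_Dr. Qed.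

Lemma pure_balanced a b c : pure (a * f b) c = pure a (g b * c).
Proof. exact/tensor_sumP/tensor_eq_balanced. Qed.

Lemma pureM a a' c c' : pure a c * pure a' c' = pure (a * a') (c * c').
Proof. by rewrite [LHS]tensor_mulE. Qed.

Lemma tensor_sumE u : tensor_sum u = \sum_(x <- u) pure x.1 x.2.
Proof.
elim: u => [|[a c] u IH]; first by rewrite big_nil.
by rewrite big_cons -IH [RHS]tensor_addE.
Qed.

Definition tensor_inl (a : A) : tensor := pure a 1.
Definition tensor_inr (c : C) : tensor := pure 1 c.

Lemma tensor_inl_is_zmod_morphism : zmod_morphism tensor_inl.
Proof.
move=> x y; apply/(addIr (tensor_inl y)); rewrite subrK.
by rewrite -pureDl subrK.
Qed.

Lemma tensor_inl_is_monoid_morphism : monoid_morphism tensor_inl.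
Proof. by split=> // x y; rewrite /tensor_inl pureM mulr1. Qed.

HB.instance Definition _ := GRing.isZmodMorphism.Build A tensor tensor_inl
  tensor_inl_is_zmod_morphism.
HB.instance Definition _ := GRing.isMonoidMorphism.Build A tensor tensor_inl
  tensor_inl_is_monoid_morphism.

Lemma tensor_inr_is_zmod_morphism : zmod_morphism tensor_inr.
Proof.
move=> x y; apply/(addIr (tensor_inr y)); rewrite subrK.
by rewrite -pureDr subrK.
Qed.

Lemma tensor_inr_is_monoid_morphism : monoid_morphism tensor_inr.
Proof. by split=> // x y; rewrite /tensor_inr pureM mulr1. Qed.

HB.instance Definition _ := GRing.isZmodMorphism.Build C tensor tensor_inr
  tensor_inr_is_zmod_morphism.
HB.instance Definition _ := GRing.isMonoidMorphism.Build C tensor tensor_inr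
  tensor_inr_is_monoid_morphism.

Lemma tensor_lift (M : zmodType) (phi : A -> C -> M) :
  (forall a a' c, phi (a + a') c = phi a c + phi a' c) ->
  (forall a c c', phi a (c + c') = phi a c + phi a c') ->
  (forall a b c, phi (a * f b) c = phi a (g b * c)) ->
  exists psi : {additive tensor -> M}, forall a c, psi (pure a c) = phi a c.
Proof.
move=> phiDl phiDr phiB.
have phi0l c : phi 0 c = 0 by apply: (addrI (phi 0 c)); rewrite -phiDl !addr0.
have phi0r a : phi a 0 = 0 by apply: (addrI (phi a 0)); rewrite -phiDr !addr0.
pose F (u : seq (A * C)) := \sum_(x <- u) phi x.1 x.2.
have F_eq u v : tensor_eq u v -> F u = F v.
  rewrite /F; elim=> {u v} [u v uv|//|u v w _ -> _ //|u u' v v' _ uu' _ vv'|c|a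
                           |a a' c|a c c'|a b c].
  - exact: perm_big.
  - by rewrite !big_cat /= uu' vv'.
  - by rewrite big_seq1 big_nil.
  - by rewrite big_seq1 big_nil.
  - by rewrite !big_cons !big_nil !addr0 phiDl.
  - by rewrite !big_cons !big_nil !addr0 phiDr.
  - by rewrite !big_seq1 phiB.
pose psi (x : tensor) := F (repr x).
have psiE u : psi (tensor_sum u) = F u by apply/F_eq/tensor_reprK.
have psiD : {morph psi : x y / x + y}.
  move=> x y; rewrite -(tensor_sumK x) -(tensor_sumK y).
  by rewrite [X in psi X]tensor_addE !psiE /F big_cat.
have psiB : zmod_morphism psi.
  by move=> x y; apply: (addIr (psi y)); rewrite subrK -psiD subrK.
pose psiM := GRing.isZmodMorphism.Build tensor M psi psiB.
exists (HB.pack_for {additive tensor -> M} psi psiM) => a c /=.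
by rewrite psiE /F big_seq1.
Qed.

Inductive tensor_homog (hA : nat -> A -> Prop) (hC : nat -> C -> Prop)
    (d : nat) : tensor -> Prop :=
| tensor_homog0 : tensor_homog hA hC d 0
| tensor_homogD x y : tensor_homog hA hC d x -> tensor_homog hA hC d y ->
    tensor_homog hA hC d (x + y)
| tensor_homog_pure i j a c : (i + j)%N = d -> hA i a -> hC j c ->
    tensor_homog hA hC d (pure a c).

End TensorProduct.

Section BottSamelson.
Variables (K : realType) (S : finType) (m : coxeter_matrix S).
Local Notation R := (cox_sym K S).

(* A partial product K (x) R (x) ... (x) R, with its structure maps from K
   (leftmost factor) and from R (rightmost factor; for the empty product, the
   quotient map R -> K), and its homogeneous elements of each degree. *)
Record bs_stage := BSStage {
  bs_ring :> comPzRingType;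
  bs_scalar : {rmorphism K -> bs_ring};
  bs_right : {rmorphism R -> bs_ring};
  bs_homog : nat -> bs_ring -> Prop
}.

Definition bs_nil : bs_stage :=
  @BSStage K idfun (mcoeff 0%MM) (fun d c => d = 0%N \/ c = 0).

Definition bs_rcons (B : bs_stage) (s : S) : bs_stage :=
  let l := bs_right B \o cox_inv_incl K m s in
  let r := cox_inv_incl K m s in
  @BSStage (tensor l r) (@tensor_inl _ _ _ l r \o bs_scalar B)
    (@tensor_inr _ _ _ l r)
    (tensor_homog (@bs_homog B) (fun d (p : R) => p \is d.-homog)).

Definition bott_samelson (w : seq S) : bs_stage := foldl bs_rcons bs_nil w.

End BottSamelson.

Section Presentation.
Variables (K : realType) (S : finType) (m : coxeter_matrix S).
Variables (n : nat) (w : n.-tuple S).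

Definition bs_Rmx : 'M[K]_n :=
  \matrix_(i, j) if (i < j)%N then cos (cox_angle K m (tnth w i) (tnth w j))
                 else 0.

Definition bs_Qmx : 'M[K]_n := \sum_(1 <= k < n.+1) bs_Rmx ^+ k.

Definition bs_quad (k : 'I_n) : {mpoly K[n]} :=
  'X_k ^+ 2 - (\sum_(l < n | (l < k)%N) bs_Qmx l k *: 'X_l) ^+ 2.

Definition bs_ideal : {pred {mpoly K[n]}} :=
  fun p => `[< exists c : 'I_n -> {mpoly K[n]}, p = \sum_k c k * bs_quad k >].

Lemma bs_ideal_closed : idealr_closed bs_ideal.
Proof.
split=> [||a p q /asboolP[c ->] /asboolP[d ->]].
- apply/asboolP; exists (fun=> 0).
  by rewrite big1 // => k _; rewrite mul0r.
- apply/asboolP=> -[c /(congr1 (mcoeff 0%MM))]; rewrite rmorph1 rmorph_sum /=.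
  rewrite big1 ?(rwP eqP) ?oner_eq0 // => k _.
  rewrite rmorphM rmorphB !rmorphXn rmorph_sum /= mcoeffX mnm1_eq0 expr0n.
  rewrite big1 ?expr0n ?subrr ?mulr0 // => l _.
  by rewrite mcoeffZ mcoeffX mnm1_eq0 mulr0.
- apply/asboolP; exists (fun k => a * c k + d k).
  by rewrite mulr_sumr -big_split; apply: eq_bigr => k _;
     rewrite mulrDl mulrA.
Qed.

HB.instance Definition _ :=
  isIdealr.Build {mpoly K[n]} bs_ideal bs_ideal_closed.

Definition bs_quot : comNzRingType := {ideal_quot bs_ideal}.

Definition bs_quot_pi : {rmorphism {mpoly K[n]} -> bs_quot} := \pi_{ideal_quot bs_ideal}.

Definition bs_quot_homog (d : nat) (x : bs_quot) : Prop :=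
  exists2 p : {mpoly K[n]}, p \is d.-homog & x = bs_quot_pi p.

End Presentation.

(* Main.v *)
Require Import Defs.
From HB Require Import structures.
From mathcomp Require Import all_boot all_order all_algebra.
From mathcomp Require Import generic_quotient ring_quotient.
From mathcomp Require Import boolp reals trigo.
From mathcomp Require Import mpoly.

Set Implicit Arguments.
Unset Strict Implicit.
Unset Printing Implicit Defensive.

Import GRing.Theory Num.Theory.

Local Open Scope ring_scope.

(* Let [x_k] be [alpha_(s_k)] placed in the [k]-th factor and [y_k] the same
   root placed in the factor before it. Since [alpha_(s_k) ^+ 2] is invariant,
   [x_k ^+ 2 = y_k ^+ 2]. For a vector [v], the part of [v] orthogonal to
   [alpha_(s_k)] is invariant and so crosses the [k]-th tensor sign, whence the
   right action of [v] is [\sum_k (v, alpha_(s_k)) (x_k - y_k)]. For row vectors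
   this gives [y = (y - x) R], that is [y = - x R (1 - R)^-1 = - x Q], and the
   relations become [x_k ^+ 2 = (\sum_l q_(lk) x_l) ^+ 2]. These are all the
   relations: by induction on the length of the word, a morphism out of the
   Bott-Samelson ring is the same thing as a solution of these equations,
   because [R^s] is generated by the constants, [alpha_s ^+ 2] and the hyperplane
   orthogonal to [alpha_s]. *)

(** * Ring morphisms out of a tensor product *)

Section TensorMorphisms.
Variables (B A C T : comPzRingType).
Variables (f : {rmorphism B -> A}) (g : {rmorphism B -> C}).

Lemma pureE a c : pure f g a c = tensor_inl f g a * tensor_inr f g c.
Proof. by rewrite pureM mulr1 mul1r. Qed.

Lemma tensor_ind (P : tensor f g -> Prop) :
  P 0 -> (forall x y, P x -> P y -> P (x + y)) ->
  (forall a c, P (tensor_inl f g a * tensor_inr f g c)) -> forall x, P x.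
Proof.
move=> P0 PD Pp x; rewrite -(tensor_sumK x) tensor_sumE.
by elim/big_ind: _ => // y _; rewrite pureE.
Qed.

Lemma tensor_rmorph_eq (phi psi : {rmorphism tensor f g -> T}) :
  (forall a, phi (tensor_inl f g a) = psi (tensor_inl f g a)) ->
  (forall c, phi (tensor_inr f g c) = psi (tensor_inr f g c)) -> phi =1 psi.
Proof.
move=> eql eqr; elim/tensor_ind => [|x y ex ey|a c]; first by rewrite !rmorph0.
  by rewrite !rmorphD ex ey.
by rewrite !rmorphM eql eqr.
Qed.

(** The tensor product is the pushout of commutative rings: [phi a * rho c] is biadditive and
    balanced, and multiplicativity of the induced map need only be checked on pure tensors. *)
Lemma tensor_lift_rmorph (phi : {rmorphism A -> T}) (rho : {rmorphism C -> T}) :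
  (forall b, phi (f b) = rho (g b)) ->
  exists psi : {rmorphism tensor f g -> T},
    (forall a, psi (tensor_inl f g a) = phi a) /\
    (forall c, psi (tensor_inr f g c) = rho c).
Proof.
move=> phi_rho.
have [|||psi psiE] := @tensor_lift _ _ _ f g T (fun a c => phi a * rho c).
- by move=> a a' c; rewrite rmorphD mulrDl.
- by move=> a c c'; rewrite rmorphD mulrDr.
- by move=> a b c; rewrite !rmorphM phi_rho mulrA.
have psiM : monoid_morphism psi.
  split; first by rewrite [LHS]psiE !rmorph1 mulr1.
  elim/tensor_ind => [y|x x' IH IH' y|a c]; first by rewrite mul0r raddf0 mul0r.
    by rewrite mulrDl !raddfD IH IH' mulrDl.
  elim/tensor_ind => [|y y' IH IH'|a' c']; first by rewrite mulr0 raddf0 mulr0.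
    by rewrite mulrDr !raddfD IH IH' mulrDr.
  by rewrite -!pureE pureM !psiE !rmorphM mulrACA.
pose psi0 : tensor f g -> T := psi.
pose psiR := GRing.isZmodMorphism.Build (tensor f g) T psi0 (raddfB psi).
pose psiR' := GRing.isMonoidMorphism.Build (tensor f g) T psi0 psiM.
exists (HB.pack_for {rmorphism tensor f g -> T} psi0 psiR psiR').
by split=> [a|c]; rewrite [LHS]psiE rmorph1 ?mulr1 ?mul1r.
Qed.

End TensorMorphisms.

(** * Ring morphisms out of a polynomial ring, and gradings *)

Section PolynomialMorphisms.
Variables (K : fieldType) (n : nat).

Lemma mpoly_gen_ind (P : {mpoly K[n]} -> Prop) :
  (forall c, P c%:MP) -> (forall i, P 'X_i) ->
  (forall p q, P p -> P q -> P (p + q)) ->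
  (forall p q, P p -> P q -> P (p * q)) -> forall p, P p.
Proof.
move=> PC PX PD PM p; rewrite [p]mpolyE.
apply: (big_ind P) => [||m _]; [by rewrite -mpolyC0 | exact: PD |].
rewrite -mul_mpolyC; apply: (PM) => //; rewrite mpolyXE_id.
apply: (big_ind P) => [||i _]; [by rewrite -mpolyC1 | exact: (PM) |].
by elim: (m i) => [|e IH]; [rewrite expr0 -mpolyC1 | rewrite exprS; apply: PM].
Qed.

Lemma mpoly_rmorph_eq (A : comPzRingType)
    (f g : {rmorphism {mpoly K[n]} -> A}) :
  (forall c, f c%:MP = g c%:MP) -> (forall i, f 'X_i = g 'X_i) -> f =1 g.
Proof.
move=> fgC fgX; apply: mpoly_gen_ind => // p q fp fq.
  by rewrite !rmorphD fp fq.
by rewrite !rmorphM fp fq.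
Qed.

(* [mmap] wants a nontrivial target, while [A] may be the zero ring. *)
Lemma mpoly_eval (A : comPzRingType) (iota : {rmorphism K -> A})
    (h : 'I_n -> A) :
  exists psi : {rmorphism {mpoly K[n]} -> A},
    (forall c, psi c%:MP = iota c) /\ (forall i, psi 'X_i = h i).
Proof.
have [A0|A1] := eqVneq (1 : A) 0.
  have A_eq (a b : A) : a = b by rewrite -[a]mul1r -[b]mul1r A0 !mul0r.
  pose z (_ : {mpoly K[n]}) : A := 0.
  pose zZ := GRing.isZmodMorphism.Build {mpoly K[n]} A z (fun _ _ => A_eq _ _).
  pose zM := GRing.isMonoidMorphism.Build {mpoly K[n]} A z
    (conj (A_eq _ _) (fun _ _ => A_eq _ _)).
  by exists (HB.pack_for {rmorphism {mpoly K[n]} -> A} z zZ zM).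
pose A' : comNzRingType :=
  HB.pack (GRing.ComPzRing.sort A) (GRing.PzSemiRing_isNonZero.Build A A1).
pose iZ := GRing.isZmodMorphism.Build K A' (iota : K -> A') (rmorphB iota).
pose iM := GRing.isMonoidMorphism.Build K A' (iota : K -> A')
  (conj (rmorph1 iota) (rmorphM iota)).
pose iota' := HB.pack_for {rmorphism K -> A'} (iota : K -> A') iZ iM.
pose psi : {rmorphism {mpoly K[n]} -> A'} := mmap iota' (h : 'I_n -> A').
pose psi0 := psi : {mpoly K[n]} -> A.
pose pZ := GRing.isZmodMorphism.Build {mpoly K[n]} A psi0 (rmorphB psi).
pose pM := GRing.isMonoidMorphism.Build {mpoly K[n]} A psi0
  (conj (rmorph1 psi) (rmorphM psi)).
exists (HB.pack_for {rmorphism {mpoly K[n]} -> A} psi0 pZ pM).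
split=> [c|i]; first exact: (mmapC _ iota').
exact: (etrans (mmapX _ iota' _) (mmap1U _ _)).
Qed.

(** Only closure properties are recorded, not a direct sum decomposition: they suffice to carry
    homogeneity along morphisms, and the isomorphism compares the predicates in both directions. *)
Record graded (A : comPzRingType) (iota : K -> A) (h : nat -> A -> Prop) :
    Prop := Graded {
  graded0 : forall d, h d 0;
  gradedD : forall d x y, h d x -> h d y -> h d (x + y);
  gradedM : forall d e x y, h d x -> h e y -> h (d + e)%N (x * y);
  gradedC : forall c, h 0%N (iota c)
}.

Lemma graded_mpoly (A : comPzRingType) (iota : K -> A) h
    (f : {rmorphism {mpoly K[n]} -> A}) :
  graded iota h -> (forall c, f c%:MP = iota c) -> (forall i, h 1%N (f 'X_i)) ->
  forall d p, p \is d.-homog -> h d (f p).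
Proof.
move=> gr fC fX d p /dhomogP p_d; rewrite [p]mpolyE rmorph_sum big_seq.
apply: (big_ind (h d)) => [|x y|m /p_d <-];
  [exact: (graded0 gr)|exact: (gradedD gr)|].
rewrite -mul_mpolyC rmorphM fC -[X in h X]add0n.
apply: (gradedM gr); first exact: (gradedC gr).
rewrite mpolyXE_id rmorph_prod /= mdegE.
have h1 : h 0%N 1 by rewrite -(rmorph1 f) -mpolyC1 fC; exact: (gradedC gr).
(* A parallel induction on the degree, as the sum of the exponents, and on the product of the
   powers. *)
elim/big_rec2: _ => // i e x _ hx; apply: (gradedM gr) => //.
rewrite rmorphXn; elim: (m i) => // k IH.
by rewrite exprS -add1n; apply: (gradedM gr).
Qed.

End PolynomialMorphisms.

(** * The geometric representation and the invariants of a simple reflection *)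

Section GeometricInvariants.
Variables (K : realType) (S : finType) (m : coxeter_matrix S).

Local Notation form := (cox_form m : cox_space K S -> _ -> _).
Local Notation root := (cox_root K).
Local Notation R := (cox_sym K S).

Lemma cox_form_linear_l v a b (u : cox_space K S) :
  form (a *: u + b) v = a * form u v + form b v.
Proof.
rewrite /cox_form mulr_sumr -big_split; apply: eq_bigr => s _.
rewrite mulr_sumr -big_split; apply: eq_bigr => t _.
by rewrite !ffunE /= !mulrDl !mulrA.
Qed.

Lemma cox_form_root s t : form (root s) (root t) = - cos (cox_angle K m s t).
Proof.
rewrite /cox_form (bigD1 s) //= (bigD1 t) //= !ffunE !eqxx !mul1r.
rewrite !big1 ?addr0 // => [s' ns|t' nt].
  by rewrite big1 // => t' _; rewrite !ffunE (negPf ns) !mul0r.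
by rewrite !ffunE (negPf nt) mulr0 mul0r.
Qed.

Lemma cox_form_root_sym s t : form (root s) (root t) = form (root t) (root s).
Proof. by rewrite !cox_form_root /cox_angle coxm_sym. Qed.

Lemma cox_form_root_self s : form (root s) (root s) = 1.
Proof. by rewrite cox_form_root /cox_angle coxm_diag divr1 cospi opprK. Qed.

Lemma cox_poly_linear a (u v : cox_space K S) :
  cox_poly (a *: u + v) = a *: cox_poly u + cox_poly v.
Proof.
rewrite /cox_poly scaler_sumr -big_split; apply: eq_bigr => s _.
by rewrite !ffunE /= scalerDl scalerA.
Qed.

Lemma cox_poly_root s : cox_poly (root s) = 'X_(enum_rank s) :> R.
Proof.
rewrite /cox_poly (bigD1 s) //= ffunE eqxx scale1r big1 ?addr0 // => t nt.
by rewrite ffunE (negPf nt) scale0r.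
Qed.

Lemma cox_sym_X i : 'X_i = cox_poly (root (enum_val i)) :> R.
Proof. by rewrite cox_poly_root enum_valK. Qed.

Lemma cox_space_sum (v : cox_space K S) : v = \sum_s v s *: root s.
Proof.
apply/ffunP => t; rewrite sum_ffunE (bigD1 t) //= big1 ?addr0 => [|s ns].
  by rewrite !ffunE eqxx [RHS]mulr1.
by rewrite !ffunE eq_sym (negPf ns) [LHS]mulr0.
Qed.

(** Linearity is an explicit hypothesis, so that this applies to plain composites such as those in
    [cox_act_poly]. *)
Lemma cox_space_linear_eq (M : lmodType K) (f g : cox_space K S -> M) :
  (forall a u v, f (a *: u + v) = a *: f u + f v) ->
  (forall a u v, g (a *: u + v) = a *: g u + g v) ->
  (forall s, f (root s) = g (root s)) -> f =1 g.
Proof.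
move=> f_lin g_lin fg v.
have lin0 (h : cox_space K S -> M) :
    (forall a u v, h (a *: u + v) = a *: h u + h v) -> h 0 = 0.
  by move=> h_lin; have := h_lin (-1) 0 0; rewrite scaler0 addr0 scaleN1r addNr.
rewrite (cox_space_sum v); elim/big_ind: _ => [|u u' fu fu'|s _].
- by rewrite !lin0.
- by rewrite -[u]scale1r f_lin g_lin fu fu'.
- by rewrite -[_ *: _]addr0 f_lin g_lin !lin0 // fg.
Qed.

Lemma cox_form_suml (v w : cox_space K S) :
  form v w = \sum_s v s * form (root s) w.
Proof.
rewrite {1}/cox_form; apply: eq_bigr => s _.
rewrite /cox_form [in RHS](bigD1 s) //= [X in _ + X]big1 ?addr0 => [|t ts].
  by rewrite mulr_sumr; apply: eq_bigr => t _; rewrite ffunE eqxx mul1r mulrA.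
by rewrite big1 // => u _; rewrite ffunE (negPf ts) !mul0r.
Qed.

Lemma cox_poly_refl s v : cox_poly (cox_refl m s v)
  = cox_poly v - (2 * form v (root s)) *: cox_poly (root s) :> R.
Proof. by rewrite /cox_refl addrC -scaleNr cox_poly_linear scaleNr addrC. Qed.

Lemma cox_act_poly s :
  cox_act m s \o @cox_poly K S =1 @cox_poly K S \o cox_refl m s.
Proof.
apply: cox_space_linear_eq => [a u v|a u v|t] /=.
- by rewrite cox_poly_linear linearP.
- rewrite !cox_poly_refl cox_form_linear_l cox_poly_linear scalerBr scalerA.
  by rewrite mulrDr mulrCA scalerDl opprD addrACA.
- rewrite cox_poly_root /cox_act comp_mpolyXU -tnth_nth tnth_mktuple.
  by rewrite enum_rankK.
Qed.

Lemma cox_act_orth s (v : cox_space K S) :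
  form v (root s) = 0 -> cox_act m s (cox_poly v) = cox_poly v.
Proof.
move=> v0; rewrite [LHS]cox_act_poly /= cox_poly_refl.
by rewrite v0 mulr0 scale0r subr0.
Qed.

Lemma cox_act_root s : cox_act m s (cox_poly (root s)) = - cox_poly (root s).
Proof.
rewrite [LHS]cox_act_poly /= cox_poly_refl cox_form_root_self mulr1.
by rewrite scaler_nat mulr2n opprD addNKr.
Qed.

(** Orthogonal projection, available because roots have norm 1. The component [u] is fixed by [s],
    so it can cross the tensor sign over the [s]-invariants. *)
Lemma cox_refl_decomp s (v : cox_space K S) :
  exists2 u, form u (root s) = 0 & v = form v (root s) *: root s + u.
Proof.
exists (v - form v (root s) *: root s); last by rewrite addrC subrK.
by rewrite addrC -scaleNr cox_form_linear_l cox_form_root_self mulr1 addNr.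
Qed.

(* Every polynomial is [a + b alpha_s] with [a] and [b] in the subring generated
   by the constants, [alpha_s ^+ 2] and the hyperplane orthogonal to [alpha_s];
   if it is [s]-invariant then [2 b alpha_s = 0]. *)
Lemma cox_inv_rmorph_eq (T : comPzRingType) s (f g : {rmorphism R -> T}) :
  (forall c, f c%:MP = g c%:MP) ->
  (forall v, form v (root s) = 0 -> f (cox_poly v) = g (cox_poly v)) ->
  f (cox_poly (root s)) ^+ 2 = g (cox_poly (root s)) ^+ 2 ->
  forall p, cox_act m s p = p -> f p = g p.
Proof.
move=> fgC fgV fg2; pose al : R := cox_poly (root s).
pose E (p : R) := cox_act m s p = p /\ f p = g p.
have EC c : E c%:MP by split; [exact: comp_mpolyC | exact: fgC].
have ED p q : E p -> E q -> E (p + q).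
  by move=> [ip fp] [iq fq]; split; rewrite !rmorphD /= ?ip ?iq ?fp ?fq.
have EM p q : E p -> E q -> E (p * q).
  by move=> [ip fp] [iq fq]; split; rewrite !rmorphM /= ?ip ?iq ?fp ?fq.
have E2 : E (al * al).
  split; first by rewrite rmorphM /= cox_act_root mulrNN.
  by rewrite !rmorphM.
have decomp p : exists2 ab : R * R, p = ab.1 + ab.2 * al & E ab.1 /\ E ab.2.
  elim/mpoly_gen_ind: p => [c|i|_ _ [[a b] -> [Ea Eb]] [[c d] -> [Ec Ed]]|
                            _ _ [[a b] -> [Ea Eb]] [[c d] -> [Ec Ed]]] /=.
  - by exists (c%:MP, 0%:MP); rewrite //= mpolyC0 mul0r addr0.
  - rewrite cox_sym_X; have [u u0 ->] := cox_refl_decomp s (root (enum_val i)).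
    exists (cox_poly u, (form (root (enum_val i)) (root s))%:MP) => /=.
      by rewrite cox_poly_linear mul_mpolyC addrC.
    by split=> //; split; [exact: cox_act_orth | exact: fgV].
  - by exists (a + c, b + d) => /=; [rewrite mulrDl addrACA | split; exact: ED].
  (* The product [(a + b al) (c + d al)] multiplied out; its [al ^+ 2] term belongs to the constant
     part by [E2]. *)
  - exists (a * c + b * d * (al * al), a * d + b * c) => /=; last by split; auto.
    rewrite mulrDl !mulrDr (mulrA a d) (mulrAC b al c) (mulrACA b al d al).
    by rewrite mulrDl [RHS]addrAC !addrA.
move=> p; have [[a b] -> [[ia fa] [ib fb]]] := decomp p.
rewrite rmorphD rmorphM /= ia ib cox_act_root mulrN => /addrI bal.
have /eqP : (2 : K) *: (b * al) = 0.
  by rewrite scaler_nat mulr2n -{1}bal addNr.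
rewrite scaler_eq0 mulf_eq0 pnatr_eq0 /= => /orP[/eqP -> | /eqP al0].
  by rewrite mul0r addr0.
by rewrite al0 mulr0 addr0.
Qed.

End GeometricInvariants.

(** * The matrix Q and the universal property of Bott-Samelson rings *)

Section Presentation.
Variables (K : realType) (S : finType) (m : coxeter_matrix S).
Variables (n : nat) (w : n.-tuple S).

Local Notation form := (cox_form m : cox_space K S -> _ -> _).
Local Notation root := (cox_root K).
Local Notation R := (cox_sym K S).
Local Notation rmx := (bs_Rmx K m w).
Local Notation Q := (bs_Qmx K m w).

(** R is strictly upper triangular, so each further factor pushes the support one more diagonal
    away; in particular R is nilpotent. *)
Lemma bs_Rmx_exp_eq0 e (i j : 'I_n) : (j < i + e)%N -> (rmx ^+ e) i j = 0.
Proof.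
elim: e i j => [|e IH] i j.
  by rewrite addn0 => ji; rewrite expr0 mxE -val_eqE /= gtn_eqF.
rewrite addnS exprSr mxE => jie; apply: big1 => k _; rewrite [rmx k j]mxE.
have [kj|] := ltnP k j; last by rewrite mulr0.
by rewrite IH ?mul0r // -ltnS (leq_ltn_trans kj).
Qed.

Lemma bs_Qmx_eq0 (i j : 'I_n) : (j <= i)%N -> Q i j = 0.
Proof.
move=> ji; rewrite summxE big_nat big1 // => -[//|e] _.
by rewrite bs_Rmx_exp_eq0 // addnS ltnS (leq_trans ji) ?leq_addr.
Qed.

(** Q is a truncated geometric series, and the right-hand side exceeds it only by the power of
    exponent [n.+1], which vanishes by nilpotency. *)
Lemma bs_Qmx_rec : Q = rmx + Q *m rmx.
Proof.
have -> : Q *m rmx = \sum_(1 <= e < n.+1) rmx ^+ e.+1.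
  by rewrite mulmx_suml; apply: eq_bigr => e _; rewrite exprSr.
have -> : rmx = rmx ^+ 1 by rewrite expr1.
rewrite -(big_add1 _ _ 1 n.+2 xpredT (fun e => rmx ^+ e)).
rewrite -(big_ltn (F := fun e => rmx ^+ e)) // [in RHS]big_nat_recr //=.
rewrite [X in _ + X](_ : _ = 0) ?addr0 ?expr1 //.
by apply/matrixP => i j; rewrite bs_Rmx_exp_eq0 ?mxE // ltn_addl // ltnS ltnW.
Qed.

(** * Linear forms giving the right action in terms of the generators *)

Section Coordinates.
Variables (T : comPzRingType) (iota : {rmorphism K -> T}) (t : 'I_n -> T).

(** This is [y_k] written in the [x_l]. The unrestricted sum only involves [l < k], because Q is
    strictly upper triangular. *)
Definition bs_tail (k : 'I_n) : T := - \sum_l iota (Q l k) * t l.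

(** The right action of [v] after [k] factors. The index [k] is a natural number so that it can
    reach [n]. *)
Definition bs_lin (k : nat) (v : cox_space K S) : T :=
  \sum_(j < n | (j < k)%N) iota (form v (root (tnth w j))) * (t j - bs_tail j).

Lemma bs_linS (k : 'I_n) v : bs_lin k.+1 v
  = bs_lin k v + iota (form v (root (tnth w k))) * (t k - bs_tail k).
Proof.
rewrite /bs_lin (bigD1 k) //= addrC; congr (_ + _); apply: eq_bigl => j.
by rewrite ltnS ltn_neqAle andbC.
Qed.

Lemma bs_lin_linear k a u v :
  bs_lin k (a *: u + v) = iota a * bs_lin k u + bs_lin k v.
Proof.
rewrite /bs_lin mulr_sumr -big_split; apply: eq_bigr => j _ /=.
by rewrite cox_form_linear_l rmorphD rmorphM mulrDl mulrA.
Qed.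

Lemma bs_lin_suml k v : bs_lin k v = \sum_s iota (v s) * bs_lin k (root s).
Proof.
rewrite /bs_lin; under [RHS]eq_bigr do rewrite mulr_sumr.
rewrite exchange_big; apply: eq_bigr => j _ /=.
rewrite cox_form_suml rmorph_sum mulr_suml; apply: eq_bigr => s _.
by rewrite rmorphM mulrA.
Qed.

(* The identity [Q = R + Q R] is what makes [bs_tail], defined by the matrix
   [Q], the value of the right action on [alpha_(s_k)] before step [k]. *)
Lemma bs_lin_root (k : 'I_n) : bs_lin k (root (tnth w k)) = bs_tail k.
Proof.
(* The form of the two roots is minus the entry of R when [j < k], and R vanishes at the other
   indices, which absorbs the range condition. *)
transitivity (- \sum_j iota (rmx j k) * (t j - bs_tail j)).
  rewrite -sumrN /bs_lin big_mkcond; apply: eq_bigr => j _.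
  rewrite mxE; case: ifP => _; last by rewrite rmorph0 mul0r oppr0.
  by rewrite cox_form_root_sym cox_form_root rmorphN mulNr.
rewrite /bs_tail; congr (- _).
under eq_bigr do rewrite opprK mulrDr mulr_sumr.
rewrite big_split exchange_big -big_split; apply: eq_bigr => l _ /=.
rewrite {2}bs_Qmx_rec !mxE rmorphD rmorph_sum mulrDl mulr_suml; congr (_ + _).
by apply: eq_bigr => j _; rewrite rmorphM mulrCA mulrA.
Qed.

(** The root has norm 1, so step [k] adds [t k - bs_tail k] to the previous value [bs_tail k]. *)
Lemma bs_lin_rootS (k : 'I_n) : bs_lin k.+1 (root (tnth w k)) = t k.
Proof.
by rewrite bs_linS bs_lin_root cox_form_root_self rmorph1 mul1r addrC subrK.
Qed.

Lemma rmorph_cox_poly k (f : {rmorphism R -> T}) :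
  (forall c, f c%:MP = iota c) ->
  (forall s, f (cox_poly (root s)) = bs_lin k (root s)) ->
  forall v, f (cox_poly v) = bs_lin k v.
Proof.
move=> fC fr v; rewrite bs_lin_suml rmorph_sum; apply: eq_bigr => s _.
by rewrite -mul_mpolyC rmorphM fC -cox_poly_root fr.
Qed.

End Coordinates.

(** The values at [l >= k] may differ freely, since column [k] of Q is zero there; this lets tails
    pass from a prefix of the word to a longer one. *)
Lemma bs_tail_eq (T U : comPzRingType) (iT : {rmorphism K -> T})
    (iU : {rmorphism K -> U}) (f : {rmorphism T -> U}) t u (k : 'I_n) :
  (forall c, f (iT c) = iU c) ->
  (forall l : 'I_n, (l < k)%N -> f (t l) = u l) ->
  f (bs_tail iT t k) = bs_tail iU u k.
Proof.
move=> fi ft; rewrite rmorphN rmorph_sum; congr (- _); apply: eq_bigr => l _.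
rewrite rmorphM fi; have [/ft -> //|kl] := ltnP l k.
by rewrite bs_Qmx_eq0 // rmorph0 !mul0r.
Qed.

Lemma bs_lin_eq (T U : comPzRingType) (iT : {rmorphism K -> T})
    (iU : {rmorphism K -> U}) (f : {rmorphism T -> U}) t u k v :
  (forall c, f (iT c) = iU c) ->
  (forall l : 'I_n, (l < k)%N -> f (t l) = u l) ->
  f (bs_lin iT t k v) = bs_lin iU u k v.
Proof.
move=> fi ft; rewrite rmorph_sum; apply: eq_bigr => j jk.
rewrite rmorphM fi rmorphB ft // (bs_tail_eq (iU := iU) (u := u)) // => l lj.
exact: ft (ltn_trans lj jk).
Qed.

Lemma graded_bs_tail (T : comPzRingType) (iota : {rmorphism K -> T}) h t
    (k : 'I_n) : graded iota h ->
  (forall l : 'I_n, (l < k)%N -> h 1%N (t l)) -> h 1%N (bs_tail iota t k).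
Proof.
move=> gr ht; rewrite /bs_tail -sumrN.
apply: (big_ind (h 1%N)) => [|a c|l _]; first exact: (graded0 gr).
  exact: (gradedD gr).
rewrite -mulNr -rmorphN; have [lk|kl] := ltnP l k.
  by rewrite -[1%N]add0n; apply: (gradedM gr); [exact: (gradedC gr) | exact: ht].
by rewrite bs_Qmx_eq0 // oppr0 rmorph0 mul0r; exact: (graded0 gr).
Qed.

Lemma graded_bs_lin (T : comPzRingType) (iota : {rmorphism K -> T}) h t k v :
  graded iota h -> (forall l : 'I_n, (l < k)%N -> h 1%N (t l)) ->
  h 1%N (bs_lin iota t k v).
Proof.
move=> gr ht; apply: (big_ind (h 1%N)) => [|a c|j jk]; first exact: (graded0 gr).
  exact: (gradedD gr).
rewrite -[1%N]add0n; apply: (gradedM gr); first exact: (gradedC gr).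
apply: (gradedD gr); first exact: ht.
rewrite -mulN1r -(rmorph1 iota) -rmorphN -[1%N]add0n.
apply: (gradedM gr); first exact: (gradedC gr).
by apply: graded_bs_tail => // l lj; apply: ht; exact: ltn_trans lj jk.
Qed.

(* [x] lists the images of [alpha_(s_1)], ..., [alpha_(s_k)] placed in the
   successive tensor factors; its values at indices [>= k] are irrelevant. The
   last two fields say that a morphism out of [B] over [K] is the same thing as
   a solution [t] of the equations [t_i ^+ 2 = bs_tail t i]. *)
Record bs_presented (B : bs_stage K S) (k : nat) (x : 'I_n -> B) : Prop :=
BSPresented {
  bs_rightC : forall c, bs_right B c%:MP = bs_scalar B c;
  bs_right_poly : forall v,
    bs_right B (cox_poly v) = bs_lin (bs_scalar B) x k v;
  bs_gen_sqr : forall i : 'I_n, (i < k)%N ->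
    x i ^+ 2 = bs_tail (bs_scalar B) x i ^+ 2;
  bs_graded : graded (bs_scalar B) (@bs_homog _ _ B);
  bs_gen_homog : forall i : 'I_n, (i < k)%N -> bs_homog 1 (x i);
  bs_graded_rmorph : forall (T : comPzRingType) (f : {rmorphism B -> T})
      (iota : {rmorphism K -> T}) h,
    graded iota h -> (forall c, f (bs_scalar B c) = iota c) ->
    (forall i : 'I_n, (i < k)%N -> h 1%N (f (x i))) ->
    forall d b, bs_homog d b -> h d (f b);
  bs_rmorph_eq : forall (T : comPzRingType) (f g : {rmorphism B -> T}),
    (forall c, f (bs_scalar B c) = g (bs_scalar B c)) ->
    (forall i : 'I_n, (i < k)%N -> f (x i) = g (x i)) -> f =1 g;
  bs_rmorph_ex : forall (T : comPzRingType) (iota : {rmorphism K -> T})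
      (t : 'I_n -> T),
    (forall i : 'I_n, (i < k)%N -> t i ^+ 2 = bs_tail iota t i ^+ 2) ->
    exists phi : {rmorphism B -> T},
      (forall c, phi (bs_scalar B c) = iota c) /\
      (forall i : 'I_n, (i < k)%N -> phi (x i) = t i)
}.

(** The empty product is [K], on which V acts by zero, the empty sum [bs_lin]. The zero family is a
    placeholder: no index lies below 0. *)
Lemma bs_nil_presented : bs_presented (B := bs_nil K S) 0 (fun=> 0).
Proof.
split=> //=.
- by move=> c; rewrite mcoeffC eqxx mulr1.
- move=> v; rewrite /bs_lin big_pred0 // raddf_sum big1 // => s _.
  by rewrite /= mcoeffZ mcoeffX mnm1_eq0 mulr0.
- split=> [d|d x y|d e x y|c]; [by right | | | by left].
    by case=> [-> _|-> //]; [left | rewrite add0r].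
  case=> [->|->]; last by rewrite mul0r; right.
  by case=> [->|->]; [left | rewrite mulr0; right].
- move=> T f iota h gr fi _ d b [->|->]; first by rewrite fi; exact: (gradedC gr).
  by rewrite rmorph0; exact: (graded0 gr).
- by move=> T iota t _; exists iota.
Qed.

(** * The inductive step: adjoining one tensor factor *)

Section Step.
Variables (B : bs_stage K S) (k : 'I_n) (x : 'I_n -> B).
Hypothesis Bx : bs_presented k x.

Local Notation s := (tnth w k).
Local Notation B' := (bs_rcons m B s).
Let inl : {rmorphism B -> B'} :=
  tensor_inl (bs_right B \o cox_inv_incl K m s) (cox_inv_incl K m s).
Let al : R := cox_poly (root s).

(** The balancing relation at [1 (x) 1] moves an invariant across the last tensor sign. *)
Lemma bs_rcons_right p :
  cox_act m s p = p -> bs_right B' p = inl (bs_right B p).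
Proof.
move=> /eqP p_inv; pose b := @CoxInv K S m s p p_inv.
have := pure_balanced (bs_right B \o cox_inv_incl K m s) (cox_inv_incl K m s)
  1 b 1.
by rewrite mul1r mulr1; exact: esym.
Qed.

(** Only [i <= k] is meaningful; larger indices receive the new root as a default value. *)
Definition bs_rcons_gen (i : 'I_n) : B' :=
  if (i < k)%N then inl (x i) else bs_right B' al.

Lemma bs_rcons_gen_lt (i : 'I_n) : (i < k)%N -> bs_rcons_gen i = inl (x i).
Proof. by rewrite /bs_rcons_gen => ->. Qed.

Lemma bs_rcons_gen_eq : bs_rcons_gen k = bs_right B' al.
Proof. by rewrite /bs_rcons_gen ltnn. Qed.

Lemma bs_rcons_tail (i : 'I_n) : (i <= k)%N ->
  inl (bs_tail (bs_scalar B) x i) = bs_tail (bs_scalar B') bs_rcons_gen i.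
Proof.
move=> ik; apply: bs_tail_eq => // l li.
by rewrite bs_rcons_gen_lt // (leq_trans li).
Qed.

Lemma bs_rcons_rightC c : bs_right B' c%:MP = bs_scalar B' c.
Proof.
rewrite bs_rcons_right; last exact: comp_mpolyC.
by rewrite (bs_rightC Bx).
Qed.

(** The component of [v] along the root is given by [bs_lin_rootS]; the orthogonal component crosses
    the tensor sign and has zero coefficient in the new summand. *)
Lemma bs_rcons_right_poly v :
  bs_right B' (cox_poly v) = bs_lin (bs_scalar B') bs_rcons_gen k.+1 v.
Proof.
have [u u0 v_eq] := cox_refl_decomp m s v.
rewrite v_eq cox_poly_linear rmorphD -mul_mpolyC rmorphM bs_rcons_rightC.
rewrite bs_lin_linear bs_lin_rootS bs_rcons_gen_eq; congr (_ + _).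
rewrite bs_linS u0 rmorph0 mul0r addr0 bs_rcons_right ?cox_act_orth //.
rewrite (bs_right_poly Bx); apply: bs_lin_eq => // l lk.
by rewrite bs_rcons_gen_lt.
Qed.

(** The new relation, at [i = k], arises because the squared root is invariant: once across the
    tensor sign it is the square of the old right action, which [bs_lin_root] identifies with the
    tail. *)
Lemma bs_rcons_gen_sqr (i : 'I_n) : (i < k.+1)%N ->
  bs_rcons_gen i ^+ 2 = bs_tail (bs_scalar B') bs_rcons_gen i ^+ 2.
Proof.
rewrite ltnS => ik; rewrite -bs_rcons_tail //.
move: ik; rewrite leq_eqVlt => /predU1P[/val_inj -> | ik]; last first.
  by rewrite bs_rcons_gen_lt // -!rmorphXn (bs_gen_sqr Bx).
rewrite bs_rcons_gen_eq -!rmorphXn bs_rcons_right.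
  by rewrite rmorphXn (bs_right_poly Bx) bs_lin_root.
by rewrite rmorphXn /= cox_act_root sqrrN.
Qed.

Lemma bs_rcons_presented : bs_presented k.+1 bs_rcons_gen.
Proof.
have [h0 hD hM hC] := bs_graded Bx.
have gr' : graded (bs_scalar B') (@bs_homog _ _ B').
  split=> [d|d a b|d e a b|c].
  - exact: tensor_homog0.
  - exact: tensor_homogD.
  - move=> ha hb; elim: ha => [|a1 a2 _ IH1 _ IH2|i j a1 c1 <- ha1 hc1].
    + by rewrite mul0r; exact: tensor_homog0.
    + by rewrite mulrDl; exact: tensor_homogD.
    elim: hb => [|b1 b2 _ IH1 _ IH2|i' j' a2 c2 <- ha2 hc2].
    + by rewrite mulr0; exact: tensor_homog0.
    + by rewrite mulrDr; exact: tensor_homogD.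
    rewrite pureM; apply: (@tensor_homog_pure _ _ _ _ _ _ _ _ (i + i') (j + j')).
    + by rewrite addnACA.
    + exact: hM.
    + exact: dhomogM.
  - by apply: (@tensor_homog_pure _ _ _ _ _ _ _ _ 0 0) => //; exact: dhomog1.
split=> //.
- exact: bs_rcons_rightC.
- exact: bs_rcons_right_poly.
- exact: bs_rcons_gen_sqr.
- move=> i; rewrite ltnS leq_eqVlt => /predU1P[/val_inj -> | ik].
    rewrite bs_rcons_gen_eq.
    apply: (@tensor_homog_pure _ _ _ _ _ _ _ _ 0 1) => //.
      by rewrite -(rmorph1 (bs_scalar B)).
    by rewrite /al cox_poly_root dhomogX /= mdeg1.
  rewrite bs_rcons_gen_lt //.
  apply: (@tensor_homog_pure _ _ _ _ _ _ _ _ 1 0) => //; last exact: dhomog1.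
  exact: (bs_gen_homog Bx).
- move=> T f iota h gr fi fx d b.
  have f_inl e a : bs_homog e a -> h e (f (inl a)).
    apply: (bs_graded_rmorph Bx (f := f \o inl) gr) => // i ik.
    by rewrite /= -bs_rcons_gen_lt //; apply: fx; exact: leqW.
  (* The variables of R act by linear forms in the generators, whose images have degree 1. *)
  have f_inr e p : p \is e.-homog -> h e (f (bs_right B' p)).
    apply: (graded_mpoly (f := f \o bs_right B') gr) => [c|i] /=.
      by rewrite bs_rcons_rightC fi.
    rewrite cox_sym_X bs_rcons_right_poly.
    rewrite (bs_lin_eq (iU := iota) (u := f \o bs_rcons_gen)) //.
    exact: graded_bs_lin.
  elim=> [|a1 a2 _ IH1 _ IH2|i j a c <- ha hc].
  + by rewrite rmorph0; exact: (graded0 gr).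
  + by rewrite rmorphD; exact: (gradedD gr).
  by rewrite pureE rmorphM; apply: (gradedM gr); [exact: f_inl | exact: f_inr].
- move=> T f g fgC fgx; apply: tensor_rmorph_eq.
    apply: (bs_rmorph_eq Bx (f := f \o inl) (g := g \o inl)) => // i ik.
    by rewrite /= -bs_rcons_gen_lt // fgx // leqW.
  apply: (mpoly_rmorph_eq (f := f \o bs_right B') (g := g \o bs_right B')) => [c|i].
    by rewrite /= bs_rcons_rightC fgC.
  rewrite /= cox_sym_X bs_rcons_right_poly.
  rewrite (bs_lin_eq (iU := g \o bs_scalar B') (u := g \o bs_rcons_gen)) //.
  by apply/esym/bs_lin_eq.
- move=> T iota t t2.
  have [i ik|phi [phiC phix]] := bs_rmorph_ex Bx (iota := iota) (t := t).
    by rewrite t2 // leqW.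
  (* The value on the last factor is forced by [bs_rcons_right_poly]. *)
  have [rho [rhoC rhoX]] := mpoly_eval iota
    (fun i : 'I_#|S| => bs_lin iota t k.+1 (root (enum_val i))).
  have rho_lin := rmorph_cox_poly (k := k.+1) rhoC.
  have rhoV v : rho (cox_poly v) = bs_lin iota t k.+1 v.
    by apply: rho_lin => r; rewrite cox_poly_root rhoX enum_rankK.
  have phi_lin v : phi (bs_right B (cox_poly v)) = bs_lin iota t k v.
    by rewrite (bs_right_poly Bx); apply: bs_lin_eq.
  have [|psi [psil psir]] := tensor_lift_rmorph (phi := phi) (rho := rho)
      (f := bs_right B \o cox_inv_incl K m s) (g := cox_inv_incl K m s).
    move=> [p p_inv]; rewrite /=.
    (* Agreement on invariants is tested on constants, orthogonal vectors and the squared root; the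
       last test is exactly the equation [t2] at [k]. *)
    apply: (cox_inv_rmorph_eq (f := phi \o bs_right B) (g := rho)) (eqP p_inv).
    + by move=> c; rewrite /= (bs_rightC Bx) phiC rhoC.
    + by move=> v v0; rewrite /= phi_lin rhoV bs_linS v0 rmorph0 mul0r addr0.
    + by rewrite /= phi_lin rhoV bs_lin_root bs_lin_rootS t2.
  exists psi; split=> [c|i]; first by rewrite [LHS]psil phiC.
  rewrite ltnS leq_eqVlt => /predU1P[/val_inj -> | ik].
    by rewrite bs_rcons_gen_eq [LHS]psir rhoV bs_lin_rootS.
  by rewrite bs_rcons_gen_lt // [LHS]psil phix.
Qed.

End Step.

End Presentation.

(** * The quotient ring and the graded isomorphism *)

Section Quotient.
Variables (K : realType) (S : finType) (m : coxeter_matrix S).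
Variables (n : nat) (w : n.-tuple S).

Local Notation Q := (bs_Qmx K m w).
Local Notation pi := (bs_quot_pi K m w).

Lemma bott_samelson_presented :
  exists x, @bs_presented K S m n w (bott_samelson K m w) n x.
Proof.
(* The induction runs over prefixes, while Q remains the matrix of the full word; a prefix of length
   [k] sees only its first [k] columns. *)
suff P k : (k <= n)%N ->
    exists x, @bs_presented K S m n w (bott_samelson K m (take k w)) k x.
  by have := P n (leqnn n); rewrite take_oversize ?size_tuple.
elim: k => [_|k IH lt_kn].
  by rewrite take0; exists (fun=> 0); exact: bs_nil_presented.
have [x Bx] := IH (ltnW lt_kn); pose k' := Ordinal lt_kn.
rewrite (take_nth (tnth w k')) ?size_tuple // -(tnth_nth _ w k').
rewrite /bott_samelson foldl_rcons.
by eexists; exact: (bs_rcons_presented (k := k') Bx).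
Qed.

Lemma bs_quot_piK (x : bs_quot K m w) : exists p, x = pi p.
Proof. by exists (repr x); rewrite [RHS]reprK. Qed.

Lemma bs_quot_pi_eq p q : (pi p == pi q) = (p - q \in bs_ideal m w).
Proof. exact/esym/Quotient.idealrBE. Qed.

(** The sign of the tail disappears in the square, so killing the quadrics amounts to solving the
    equations of [bs_presented]. *)
Lemma bs_quad_tail (T : comPzRingType) (iota : {rmorphism K -> T})
    (f : {rmorphism {mpoly K[n]} -> T}) k :
  (forall c, f c%:MP = iota c) ->
  f (bs_quad K m w k)
    = f 'X_k ^+ 2 - bs_tail m w iota (fun i => f 'X_i) k ^+ 2.
Proof.
move=> fC; rewrite rmorphB !rmorphXn sqrrN; congr (_ - _ ^+ 2).
rewrite rmorph_sum big_mkcond; apply: eq_bigr => l _.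
rewrite -mul_mpolyC rmorphM fC; case: ltnP => // kl.
by rewrite bs_Qmx_eq0 // rmorph0 mul0r.
Qed.

Lemma bs_quot_lift (T : comPzRingType) (f : {rmorphism {mpoly K[n]} -> T}) :
  (forall k, f (bs_quad K m w k) = 0) ->
  exists psi : {rmorphism bs_quot K m w -> T}, forall p, psi (pi p) = f p.
Proof.
move=> f0; pose psi (x : bs_quot K m w) := f (repr x).
have psiE p : psi (pi p) = f p.
  apply/eqP; rewrite -subr_eq0 -rmorphB.
  have /asboolP[c ->] : repr (pi p) - p \in bs_ideal m w.
    by rewrite -bs_quot_pi_eq; apply/eqP; exact: reprK.
  by rewrite rmorph_sum big1 // => k _; rewrite rmorphM f0 mulr0.
have psiB : zmod_morphism psi.
  move=> x y; have [p ->] := bs_quot_piK x; have [q ->] := bs_quot_piK y.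
  by rewrite -rmorphB !psiE rmorphB.
have psiM : monoid_morphism psi.
  split=> [|x y]; first by rewrite -(rmorph1 pi) psiE rmorph1.
  have [p ->] := bs_quot_piK x; have [q ->] := bs_quot_piK y.
  by rewrite -rmorphM !psiE rmorphM.
pose psiZ := GRing.isZmodMorphism.Build _ T psi psiB.
pose psiR := GRing.isMonoidMorphism.Build _ T psi psiM.
by exists (HB.pack_for {rmorphism bs_quot K m w -> T} psi psiZ psiR).
Qed.

Lemma bs_quot_graded :
  graded (fun c : K => pi c%:MP) (@bs_quot_homog K S m n w).
Proof.
split=> [d|d x y [p p_d ->] [q q_d ->]|d e x y [p p_d ->] [q q_e ->]|c].
- by exists 0; rewrite ?rmorph0 ?dhomog0.
- by exists (p + q); rewrite ?rmorphD ?dhomogD.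
- by exists (p * q); rewrite ?rmorphM ?dhomogM.
- by exists c%:MP => //; rewrite -[c%:MP]mulr1 mul_mpolyC dhomogZ ?dhomog1.
Qed.

Lemma bott_samelson_presentation :
  exists phi : {rmorphism bott_samelson K m w -> bs_quot K m w},
    [/\ bijective phi,
        forall c : K, phi (bs_scalar (bott_samelson K m w) c) = pi c%:MP
      & forall (d : nat) (x : bott_samelson K m w),
          bs_homog d x <-> bs_quot_homog d (phi x)].
Proof.
have [x Bx] := bott_samelson_presented.
pose iota : {rmorphism K -> bs_quot K m w} := pi \o @mpolyC n K.
have [|phi [phiC phix]] := bs_rmorph_ex Bx (iota := iota) (t := fun i => pi 'X_i).
  (* The classes of the variables solve the equations, as each quadric lies in the ideal with
     Kronecker coefficients. *)
  move=> i _; apply/eqP; rewrite -subr_eq0 -(bs_quad_tail (f := pi)) //.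
  rewrite -(rmorph0 pi) bs_quot_pi_eq subr0.
  apply/asboolP; exists (fun k => (k == i)%:R).
  rewrite (bigD1 i) //= eqxx mul1r big1 ?addr0 // => k /negPf ->.
  by rewrite mul0r.
have [ev [evC evX]] := mpoly_eval (bs_scalar (bott_samelson K m w)) x.
have [k|psi psiE] := bs_quot_lift (f := ev).
  rewrite (bs_quad_tail (iota := bs_scalar _)) // evX (bs_gen_sqr Bx) //.
  by rewrite (_ : (fun i => ev 'X_i) = x) ?subrr //; apply: funext.
have psiK : cancel phi psi.
  apply: (bs_rmorph_eq Bx (f := psi \o phi) (g := idfun)) => [c|i _] /=.
    by rewrite phiC [LHS]psiE evC.
  by rewrite phix // psiE evX.
have phiK : cancel psi phi.
  move=> y; have [p ->] := bs_quot_piK y; rewrite psiE.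
  apply: (mpoly_rmorph_eq (f := phi \o ev) (g := pi)) => [c|i] /=.
    by rewrite evC phiC.
  by rewrite evX phix.
exists phi; split=> // [|d b]; first by exists psi.
(* Both [phi] and its inverse send generators to elements of degree 1, so each preserves
   homogeneity. *)
split=> [|[p p_d phib]].
  apply: (bs_graded_rmorph Bx (iota := iota) bs_quot_graded) => // i _.
  by rewrite phix //; exists 'X_i; rewrite ?dhomogX /= ?mdeg1.
rewrite -[b]psiK phib psiE.
apply: (graded_mpoly (bs_graded Bx)) p_d => // i.
by rewrite evX; exact: (bs_gen_homog Bx).
Qed.

End Quotient.

(** * The expanded form of the quadrics *)

Lemma sqr_sum_lt (A : comNzRingType) n (k : nat) (a : 'I_n -> A) :
  (\sum_(l < n | (l < k)%N) a l) ^+ 2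
  = \sum_(i < n) \sum_(j < n | (i <= j)%N && (j < k)%N)
      (2 - (i == j)%:R) * (a i * a j).
Proof.
(* Extension by zero removes the bound [k] from the ranges while keeping the summand symmetric. *)
pose c (i j : 'I_n) := if (i < k)%N && (j < k)%N then a i * a j else 0.
have cC i j : c i j = c j i by rewrite /c andbC mulrC.
transitivity (\sum_i \sum_j c i j).
  rewrite expr2 big_distrlr /= [in LHS]big_mkcond; apply: eq_bigr => i _.
  rewrite /c; case: (ltnP i k) => ik /=; last by rewrite big1.
  by rewrite [LHS]big_mkcond.
transitivity (\sum_(i < n) \sum_(j < n | (i <= j)%N) (2 - (i == j)%:R) * c i j).
  (* The terms below the diagonal are reflected above it: off-diagonal terms count twice and
     diagonal ones once, whence the factor [2 - (i == j)%:R]. *)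
  have -> : \sum_i \sum_j c i j
      = \sum_(i < n) \sum_(j < n | (i <= j)%N) c i j
        + \sum_(i < n) \sum_(j < n | (i < j)%N) c i j.
    rewrite [X in _ + X](_ : _ = \sum_(i < n) \sum_(j < n | (j < i)%N) c i j).
      rewrite -big_split; apply: eq_bigr => i _ /=.
      rewrite (bigID (fun j : 'I_n => (i <= j)%N)) /=; congr (_ + _).
      by apply: eq_bigl => j; rewrite -ltnNge.
    under eq_bigr do rewrite big_mkcond.
    rewrite exchange_big; apply: eq_bigr => i _.
    by rewrite [RHS]big_mkcond; apply: eq_bigr => j _; rewrite cC.
  rewrite -big_split; apply: eq_bigr => i _ /=.
  rewrite (big_mkcond (fun j : 'I_n => (i < j)%N)).
  rewrite (big_mkcond (fun j : 'I_n => (i <= j)%N)).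
  rewrite -big_split [RHS]big_mkcond; apply: eq_bigr => j _ /=.
  have [->|ij] := eqVneq i j; first by rewrite leqnn ltnn addr0 addrK mul1r.
  rewrite ltn_neqAle -val_eqE /= in ij *.
  rewrite ij subr0; case: ifP => _; last by rewrite addr0.
  by rewrite mulr_natl mulr2n.
apply: eq_bigr => i _; rewrite big_mkcond [RHS]big_mkcond.
apply: eq_bigr => j _; have [ij|//] := leqP i j.
rewrite /c /=; case: (ltnP j k) => jk; last by rewrite andbF mulr0.
by rewrite (leq_ltn_trans ij jk).
Qed.

Theorem theorem1p1 (K : realType) (WS : coxeter_system) (n : nat)
    (w : n.-tuple (cox_index WS)) :
  let m := cox_matrix WS in
  let Q := bs_Qmx K m w in
  (exists phi : {rmorphism bott_samelson K m w -> bs_quot K m w},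
    [/\ bijective phi,
        forall c : K,
          phi (bs_scalar (bott_samelson K m w) c) = bs_quot_pi K m w c%:MP
      & forall (d : nat) (x : bott_samelson K m w),
          bs_homog d x <-> bs_quot_homog d (phi x)])
  /\ (forall k : 'I_n,
    bs_quad K m w k =
      'X_k ^+ 2 -
      \sum_(i < n) \sum_(j < n | (i <= j)%N && (j < k)%N)
         ((2 - (i == j)%:R) * Q i k * Q j k) *: ('X_i * 'X_j)).
Proof.
move=> m Q; split; first exact: bott_samelson_presentation.
move=> k; rewrite /bs_quad sqr_sum_lt; congr (_ - _).
apply: eq_bigr => i _; apply: eq_bigr => j _.
rewrite -!mul_mpolyC !mpolyCM mpolyCB !(rmorph_nat (@mpolyC n K)).
by rewrite mulrACA !mulrA.
Qed.
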